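(* For every integer $n$ with $4 \leq n\leq 13$, let $f_n : \mathfrak{A}_n \to \mathfrak{B}_n$ be the recursively defined map described in the context. Then for all $w \in \mathfrak{A}_n$ one has $w \leq f_n(w)$ in the Bruhat order on $\mathfrak{S}_n$.
   Context: Permutations $w\in\mathfrak{S}_n$ are written in one-line notation $w=w_1\cdots w_n$. Let $t=\lfloor n/2\rfloor$ and $t'=\lceil n/2\rceil$. Define $\mathfrak{A}_n=\{w\in\mathfrak{S}_n : w_1\cdots w_t \text{ permutes } \{1,\dotsc,t\} \text{ and } w_{t+1}\cdots w_n \text{ permutes } \{t+1,\dotsc,n\}\}$, $\tilde{\mathfrak{A}}_n=\{w\in\mathfrak{S}_n : w_1\cdots w_{t'} \text{ permutes } \{1,\dotsc,t'\} \text{ and } w_{t'+1}\cdots w_n \text{ permutes } \{t'+1,\dotsc,n\}\}$, $\mathfrak{B}_n=\{u\in\mathfrak{S}_n : u_i\equiv i \pmod 2 \text{ for all } i\}$. For $w\in\mathfrak{S}_m$ let $w^{RU}\in\mathfrak{S}_m$ be the reverse-complement of $w$, $(w^{RU})_i=m+1-w_{m+1-i}$. For $w\in\mathfrak{S}_m$ and $1\le p\le m+1$, let $\mathrm{ins}_p(w)=w_1\cdots w_{p-1}\,(m+1)\,w_p\cdots w_m\in\mathfrak{S}_{m+1}$. For $1\le q\le m+1$ with $m+1-q$ even, let $\mathrm{inss}_q(w)=w_1\cdots w_{q-1}\,(m+1)\,w_{q+1}w_q\,w_{q+3}w_{q+2}\cdots w_m w_{m-1}\in\mathfrak{S}_{m+1}$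 (insert $m+1$ in position $q$, and swap the remaining letters $w_q,\dotsc,w_m$ in consecutive pairs; for $q=m+1$ just append $m+1$). The maps $f_n:\mathfrak{A}_n\to\mathfrak{B}_n$, $n\ge 4$, are defined recursively. The base case $f_4$ is $1234\mapsto1234$, $1243\mapsto1432$, $2134\mapsto3214$, $2143\mapsto3412$. For $n\ge5$: (1) If $n$ is odd, write $n-1=2k$. For $w\in\mathfrak{A}_n$ there is a unique pair $(a,p)$ with $a\in\mathfrak{A}_{n-1}$ and $w=\mathrm{ins}_p(a)$; set $f_n(w)=\mathrm{inss}_{2(p-k)-1}(f_{n-1}(a))$. (2) If $n$ is even, write $n-1=2k+1$. Define $\tilde f_{n-1}:\tilde{\mathfrak{A}}_{n-1}\to\mathfrak{B}_{n-1}$ by $\tilde f_{n-1}(\tilde w)=\big(f_{n-1}(\tilde w^{RU})\big)^{RU}$. For $u\in\mathfrak{A}_n$ there is a unique pair $(\tilde w,q)$ with $\tilde w\in\tilde{\mathfrak{A}}_{n-1}$ and $u=\mathrm{ins}_q(\tilde w)$; set $f_n(u)=\mathrm{inss}_{2(q-k-1)}(\tilde f_{n-1}(\tilde w))$. *)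

(* Defs.v *)
From mathcomp Require Import all_boot all_fingroup zify.

Set Implicit Arguments.
Unset Strict Implicit.
Unset Printing Implicit Defensive.

(* Permutations of {1, .., n} are elements of 'S_n, so letters and positions  *)
(* are shifted down by one: w_i is (w (i - 1)) + 1. The position arguments of *)
(* ins and inss below are the 1-based ones. In 'S_n, (s * t) i = t (s i).     *)

Definition oneline n (w : 'S_n) : seq nat := [seq (w i).+1 | i <- enum 'I_n].

(* The permutation with one-line notation s (1 if s is not such a word). *)
Definition of_oneline n (s : seq nat) : 'S_n :=
  odflt 1%g [pick w : 'S_n | oneline w == s].

(* Bruhat order: reflexive transitive closure of the relation relating u to   *)
(* v if v is longer than u and is u times a transposition; tperm i j * u is u *)
(* with the letters in positions i and j exchanged.                           *)
Definition perm_length n (w : 'S_n) : nat :=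
  #|[set ij : 'I_n * 'I_n | (ij.1 < ij.2) && (w ij.2 < w ij.1)]|.

Definition bruhat_step n : rel 'S_n := fun u v =>
  [exists i : 'I_n, exists j : 'I_n, v == (tperm i j * u)%g]
  && (perm_length u < perm_length v).

Definition bruhat n : rel 'S_n := connect (@bruhat_step n).

Definition first_letters n t : {set 'I_n} := [set i : 'I_n | i < t].

Definition split_perms n t : {set 'S_n} :=
  [set w : 'S_n | (w @: first_letters n t == first_letters n t)
               && (w @: (~: first_letters n t) == ~: first_letters n t)].

Definition frakA n : {set 'S_n} := split_perms n n./2.
Definition frakA_tilde n : {set 'S_n} := split_perms n (uphalf n).

Definition frakB n : {set 'S_n} :=
  [set u : 'S_n | [forall i : 'I_n, (u i).+1 == i.+1 %[mod 2]]].

Definition rev_perm n : 'S_n := perm (@rev_ord_inj n).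

Definition reverse_complement n (w : 'S_n) : 'S_n :=
  (rev_perm n * w * rev_perm n)%g.

(* lift_perm i ord_max w inserts the new largest letter in position i.        *)
Definition ins m (p : nat) (w : 'S_m) : 'S_m.+1 :=
  lift_perm (inord p.-1) ord_max w.

(* Exchange of positions q <-> q+1, q+2 <-> q+3, ... (0-based). If m - q is   *)
(* odd, the last position is left alone.                                      *)
Definition swap_pos (q i : nat) : nat :=
  if i < q then i else if odd (i - q) then i.-1 else i.+1.

Definition swap_ord m (q : nat) (i : 'I_m) : 'I_m := insubd i (swap_pos q i).

Lemma swap_ordK m q : involutive (@swap_ord m q).
Proof.
move=> i; apply: val_inj; rewrite /swap_ord !val_insubd.
case: (ltnP (swap_pos q i) m) => [_ | ge_sm]; last by rewrite ltnNge ge_sm.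
have ->: swap_pos q (swap_pos q i) = i; last by rewrite ltn_ord.
by rewrite /swap_pos; do 6?case: ifPn; lia.
Qed.

Definition swap_perm m (q : nat) : 'S_m := perm (inv_inj (@swap_ordK m q)).

Definition inss m (q : nat) (w : 'S_m) : 'S_m.+1 :=
  lift_perm (inord q.-1) ord_max (swap_perm m q.-1 * w)%g.

Definition f_base n (w : 'S_n) : 'S_n :=
  if oneline w == [:: 1; 2; 3; 4] then of_oneline n [:: 1; 2; 3; 4] else
  if oneline w == [:: 1; 2; 4; 3] then of_oneline n [:: 1; 4; 3; 2] else
  if oneline w == [:: 2; 1; 3; 4] then of_oneline n [:: 3; 2; 1; 4] else
  if oneline w == [:: 2; 1; 4; 3] then of_oneline n [:: 3; 4; 1; 2] else
  1%g.

(* The pair (a, p) with a in A and w = ins_p(a), p = i + 1, if there is one.  *)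
Definition ins_decomp m (A : {set 'S_m}) (w : 'S_m.+1) : option ('S_m * nat) :=
  omap (fun ai : 'S_m * 'I_m.+1 => (ai.1, ai.2.+1))
    [pick ai : 'S_m * 'I_m.+1 | (ai.1 \in A) && (w == ins ai.2.+1 ai.1)].

(* From f_m to f_n with n = m + 1; k = m./2 in both cases. *)
Definition f_step m (fm : 'S_m -> 'S_m) (w : 'S_m.+1) : 'S_m.+1 :=
  let k := m./2 in
  if odd m.+1 then
    if ins_decomp (frakA m) w is Some (a, p)
    then inss (2 * (p - k) - 1) (fm a) else 1%g
  else
    let ftilde v := reverse_complement (fm (reverse_complement v)) in
    if ins_decomp (frakA_tilde m) w is Some (v, q)
    then inss (2 * (q - k - 1)) (ftilde v) else 1%g.

(* Total on 'S_n for convenience; only the restriction to frakA n for n >= 4  *)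
(* is meaningful.                                                             *)
Fixpoint f_map n : 'S_n -> 'S_n :=
  match n return 'S_n -> 'S_n with
  | 0 => id
  | m.+1 => if m.+1 <= 4 then @f_base m.+1 else f_step (@f_map m)
  end.

(* For w in frakA n the pair of ins_decomp exists (ins_exists) and is unique  *)
(* (ins_inj), and f_map takes its value in frakB n (f_map_frakB).             *)

Lemma lift_perm_surj m (w : 'S_m.+1) : exists i a, w = lift_perm i ord_max a :> 'S_m.+1.
Proof.
pose i0 := (w^-1)%g ord_max; have wi0 : w i0 = ord_max by rewrite permKV.
pose ulsf i (s : 'S_m.+1) k := odflt k (unlift (s i) (s (lift i k))).
have ulsfK i (s : 'S_m.+1) k : lift (s i) (ulsf i s k) = s (lift i k).
  rewrite /ulsf; have := neq_lift i k.
  by rewrite -(can_eq (permK s)) => /unlift_some[] ? ? ->.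
have inj_ulsf : injective (ulsf i0 w).
  apply: can_inj (ulsf (w i0) w^-1%g) _ => k'.
  by rewrite {1}/ulsf ulsfK !permK liftK.
exists i0, (perm inj_ulsf); apply/permP=> k.
case: (unliftP i0 k) => [k'|] ->; rewrite ?lift_perm_id //.
by rewrite lift_perm_lift /= -wi0 permE ulsfK.
Qed.

Lemma split_permsP n t (w : 'S_n) : reflect (forall i : 'I_n, (w i < t) = (i < t)) (w \in split_perms n t).
Proof.
have E : (w \in split_perms n t) = (w @: first_letters n t == first_letters n t).
  rewrite inE; case: eqP => //= e.
  have ->: w @: (~: first_letters n t) = ~: (w @: first_letters n t).
    apply/setP=> x; rewrite inE.
    rewrite -[x](permKV w) !mem_imset ?inE //; exact: perm_inj.
  by rewrite e eqxx.
rewrite E; apply: (iffP eqP) => [e i | H].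
  have := mem_imset (mem (first_letters n t)) i (@perm_inj _ w).
  by rewrite e !inE.
apply/setP=> x; rewrite -[x](permKV w) mem_imset; last exact: perm_inj.
by rewrite !inE H.
Qed.

Lemma ins_exists m t (w : 'S_m.+1) : t <= m -> w \in split_perms m.+1 t ->
  exists (i : 'I_m.+1) a, [/\ t <= i, a \in split_perms m t & w = ins i.+1 a].
Proof.
move=> tm /split_permsP H; have [i [a e]] := lift_perm_surj w.
exists i, a; have ti : t <= i.
  have := H i; rewrite e lift_perm_id /= => h; lia.
split=> //; last by rewrite /ins /= inord_val.
apply/split_permsP=> k; have := H (lift i k).
have lta := ltn_ord (a k); have ltk := ltn_ord k.
rewrite e lift_perm_lift /= /bump; lia.
Qed.

Lemma ins_inj m (i j : 'I_m.+1) (a b : 'S_m) : ins i.+1 a = ins j.+1 b -> i = j /\ a = b.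
Proof.
rewrite /ins /= !inord_val => e.
have ij : i = j.
  apply: (@perm_inj _ (lift_perm i ord_max a)); by rewrite {2}e !lift_perm_id.
split=> //; subst j; apply/permP=> k; apply: (@lift_inj _ ord_max).
by rewrite -!(lift_perm_lift i) e.
Qed.

Lemma ins_decompP m t (w : 'S_m.+1) : t <= m -> w \in split_perms m.+1 t ->
  exists (i : 'I_m.+1) a, [/\ t <= i, a \in split_perms m t, w = ins i.+1 a &
    ins_decomp (split_perms m t) w = Some (a, i.+1)].
Proof.
move=> tm H; have [i [a [ti aA e]]] := ins_exists tm H; exists i, a; split=> //.
rewrite /ins_decomp; case: pickP => [[b j]|/(_ (a,i))] /=; last by rewrite aA e eqxx.
by case/andP=> _ /eqP; rewrite e => /ins_inj [-> ->].
Qed.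

Lemma frakBP n (u : 'S_n) : reflect (forall i : 'I_n, odd (u i) = odd i) (u \in frakB n).
Proof.
rewrite inE; apply: (iffP forallP) => H i; move: (H i); lia.
Qed.

Lemma swap_permE m q (i : 'I_m) : ~~ odd (m - q) -> val (swap_perm m q i) = swap_pos q i.
Proof.
move=> h; rewrite permE /swap_ord val_insubd ifT // /swap_pos.
have := ltn_ord i; do 2?case: ifP; lia.
Qed.

Lemma inss_frakB m q (a : 'S_m) : 0 < q <= m.+1 -> ~~ odd (m.+1 - q) ->
  a \in frakB m -> inss q a \in frakB m.+1.
Proof.
move=> hq oq /frakBP H; apply/frakBP=> i; rewrite /inss.
case: (unliftP (inord q.-1) i) => [k|] ->.
  rewrite lift_perm_lift permM lift_max H swap_permE ?lift0; last lia.
  rewrite /= /bump inordK ; last lia.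
  rewrite /swap_pos; do 2?case: ifP; lia.
rewrite lift_perm_id /= inordK; lia.
Qed.

Lemma reverse_complementE m (w : 'S_m) i : reverse_complement w i = rev_ord (w (rev_ord i)).
Proof. by rewrite /reverse_complement !permM !permE. Qed.

Lemma f_map_frakB n (w : 'S_n) : 4 <= n -> w \in frakA n -> f_map w \in frakB n.
Proof.
elim: n w => // m IH w.
case: (ltnP m 4) => [m3 m4|m4 _].
  have em : m = 3 by lia. subst m; move=> _. rewrite /= /f_base.
  have key s : (if s is [:: a; b; c; d] then [&& odd a, ~~odd b, odd c & ~~ odd d] else false) -> of_oneline 4 s \in frakB 4.
    move=> hs; rewrite /of_oneline; case: pickP => /= [u /eqP e|_]; last by apply/frakBP=> i; rewrite perm1.
    apply/frakBP=> i; have : odd (nth 0 s i) = odd i.+1.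
      case: s hs {e} => [|a [|b [|c [|d [|]]]]] //=; case: i => [[|[|[|[|]]]]] //= _; lia.
    rewrite -e (nth_map i) ?size_enum_ord // nth_ord_enum /=; lia.
  do 4?[case: ifP => _; first exact: key]. by apply/frakBP=> i; rewrite perm1.
move=> H.
have -> : f_map w = f_step (f_map (n := m)) w by rewrite /= leqNgt ltnS m4.
rewrite /f_step; case: ifP => om.
  have [||i [a [ti aA -> E]]] := @ins_decompP m (m./2) w; [lia| |].
    by move: H; rewrite /frakA; have -> : m.+1./2 = m./2 by lia.
  rewrite /frakA E; have := ltn_ord i => lti; apply: inss_frakB; [lia|lia|].
  exact: IH.
have [||i [a [ti aA -> E]]] := @ins_decompP m (uphalf m) w; [lia| |].
  by move: H; rewrite /frakA; have -> : m.+1./2 = uphalf m by lia.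
rewrite /frakA_tilde E; have := ltn_ord i => lti; apply: inss_frakB; [lia|lia|].
apply/frakBP=> j; rewrite reverse_complementE /=.
have := ltn_ord (f_map (reverse_complement a) (rev_ord j)).
have /frakBP/(_ (rev_ord j)) : f_map (reverse_complement a) \in frakB m.
  apply: IH => //; apply/split_permsP=> x; move/split_permsP: aA => /(_ (rev_ord x)).
  rewrite reverse_complementE /=. have := ltn_ord (a (rev_ord x)). have := ltn_ord x. lia.
rewrite /=. have := ltn_ord j; lia.
Qed.

(* Main.v *)
Require Import Defs.
From mathcomp Require Import all_boot all_fingroup.
From mathcomp Require Import zify.

(** Write [r_w(i, j)] for the number of letters at least [j] among the first [i]
    letters of [w]. The rank criterion says that [w <= v] in Bruhat order when
    [r_w <= r_v] pointwise, and it is what connects counting to the order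
    ([bruhat_rank]).

    Because of its swaps, [inss_q v] moves each letter of the parity class of
    position [q], at or after [q], two places to the right and leaves the other
    class fixed: it is an ordinary insertion of the new largest letter into the
    subword of [v] on one parity class. So where [w] receives a letter in its
    second block, [f_n w] receives it at the same index of one of two subwords.

    The inequality [r_w <= r_v] by itself does not survive such a step. The
    invariant that does is [parity_dominated w v]: for all [o] and [e] with
    [o + e = i], the bound [r_w(i, j)] also holds for the [i] letters of [v] that
    consist of the first [o] letters on one parity class and the first [e] on the
    other. It is stronger, as the choice [o = e] or [o = e + 1] recovers an
    actual prefix of [v]. For an insertion at index [r] of the class counted by
    [e], the new letter of [w] sits at position [r] plus the size of the other
    class, hence at position at least [r + o]. If [e <= r], the new letter is
    outside both sets being counted, and nothing changes. If [e > r], the set on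
    the side of [v] contains the new letter and a set of the old invariant with
    [e - 1] in place of [e], and the prefix of [w] has [i - 1] old letters
    together with one more, new or old ([parity_dominated_ins]).

    For even [n] the recursion passes through the reverse-complement of words of
    odd length. That symmetry preserves the invariant because it turns counts
    over a set of positions into counts over the reversed complement, and the
    sets used above are closed under this operation
    ([parity_dominated_reverse_complement]). *)

Set Implicit Arguments.
Unset Strict Implicit.
Unset Printing Implicit Defensive.

(** * Rank functions and the Bruhat order *)

(** The set of counted positions is arbitrary, since both genuine prefixes and
    unions of prefixes of the two parity subwords are needed. *)
Definition letters_ge n (w : 'S_n) (D : pred nat) (j : nat) : nat :=
  \sum_(a < n) (D a && (j <= w a)).

Definition rank n (w : 'S_n) (i j : nat) : nat := letters_ge w (fun a => a < i) j.

Lemma eq_letters_ge n (w : 'S_n) (D E : pred nat) j :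
  (forall a : 'I_n, D a = E a) -> letters_ge w D j = letters_ge w E j.
Proof. by move=> DE; apply: eq_bigr => a _; rewrite DE. Qed.

Lemma letters_ge_eq0 n (w : 'S_n) D j : n <= j -> letters_ge w D j = 0.
Proof.
move=> nj; rewrite /letters_ge big1 // => a _.
by rewrite leqNgt (leq_trans (ltn_ord _) nj) andbF.
Qed.

Lemma perm_length_rank n (u : 'S_n) :
  perm_length u = \sum_(c < n) rank u c (u c).+1.
Proof.
rewrite /perm_length -sum1_card big_mkcond /= exchange_big pair_big /=.
by apply: eq_bigr => -[i j] _; rewrite inE /=; case: ifP.
Qed.

Lemma rank_tperm n (u : 'S_n) (a b : 'I_n) i j : a < b -> u a < u b ->
  rank (tperm a b * u)%g i j = rank u i j + ((a < i <= b) && (u a < j <= u b)).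
Proof.
move=> ab uab; rewrite /rank /letters_ge.
have ba : b != a by rewrite -val_eqE /=; lia.
rewrite [in LHS](bigD1 a) //= (bigD1 b ba) [in RHS](bigD1 a) //=
  [in RHS](bigD1 b ba) /= !permM tpermL tpermR.
rewrite [X in _ + (_ + X)](eq_bigr (fun c : 'I_n => nat_of_bool ((c < i) && (j <= u c)))).
  by set s := \sum_(_ < n | _) _; lia.
by move=> c /andP[ca cb]; rewrite permM tpermD // eq_sym.
Qed.

(** Each position between [a] and [b] contributes at least as much for the
    smaller threshold. *)
Lemma rank_window n (u : 'S_n) (a b : nat) j j' : a <= b -> j <= j' ->
  rank u a j + rank u b j' <= rank u a j' + rank u b j.
Proof.
by move=> ab jj; rewrite /rank /letters_ge -!big_split; apply: leq_sum => c _ /=; lia.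
Qed.

(** Inversions are summed by the position of their smaller letter. Outside [a]
    and [b] no term decreases, by [rank_tperm]; the terms of [a] and [b] together
    increase by [rank_window] and the new inversion between them. *)
Lemma perm_length_tperm n (u : 'S_n) (a b : 'I_n) : a < b -> u a < u b ->
  perm_length u < perm_length (tperm a b * u)%g.
Proof.
move=> ab uab; rewrite !perm_length_rank.
have ba : b != a by rewrite -val_eqE /=; lia.
rewrite [ltnLHS](bigD1 a) //= (bigD1 b ba) [ltnRHS](bigD1 a) //=
  [\sum_(_ < n | _) rank (_ * _) _ _](bigD1 b ba) /=
  !permM tpermL tpermR.
rewrite !rank_tperm // addnA [ltnRHS]addnA -addSn; apply: leq_add.
  have := @rank_window n u a b (u a).+1 (u b).+1; lia.
apply: leq_sum => c /andP[ca cb].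
by rewrite permM tpermD 1?eq_sym // rank_tperm // leq_addr.
Qed.

Lemma rank_common_prefix n (u v : 'S_n) (a : 'I_n) j :
  (forall c : 'I_n, c < a -> u c = v c) -> rank u a j = rank v a j.
Proof. by move=> uv; apply: eq_bigr => c _; case: ltnP => //= /uv ->. Qed.

Lemma rankS n (u : 'S_n) (a : 'I_n) j : rank u a.+1 j = rank u a j + (j <= u a).
Proof.
rewrite /rank /letters_ge (bigD1 a) // [in RHS](bigD1 a) //= ltnS
  leqnn ltnn /= add0n addnC.
congr (_ + _); apply: eq_bigr => c ca; rewrite ltnS leq_eqVlt.
by rewrite [_ == _ :> nat](negbTE ca).
Qed.

(** One step up from [u] towards [v]: [a] is the first position where they
    differ, so that [u a < v a] by the rank inequality, and [b] is the next
    position holding a letter in the interval from [u a] (excluded) to [v a].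
    The exchange raises the rank by 1 on a rectangle, where the choice of [b]
    makes the inequality between the ranks strict. *)
Lemma rank_raise n (u v : 'S_n) : (forall i j, rank u i j <= rank v i j) -> u != v ->
  exists a b : 'I_n, [/\ a < b, u a < u b &
    forall i j, rank (tperm a b * u)%g i j <= rank v i j].
Proof.
move=> uv neq_uv.
have [a0 da0] : exists a, u a != v a.
  by apply/existsP; apply: contraNT neq_uv; rewrite negb_exists => /forallP uv1;
     apply/eqP/permP=> c; apply/eqP; rewrite -[_ == _]negbK.
case: (@arg_minnP _ a0 (fun a => u a != v a) val da0) => a neq_a min_a {a0 da0}.
have same (c : 'I_n) : c < a -> u c = v c.
  by move=> ca; apply/eqP; apply: contraLR ca => /min_a /=; lia.
have lt_a : u a < v a.
  move: (uv a.+1 (u a)) neq_a; rewrite !rankS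
    (rank_common_prefix _ same) -val_eqE /=; lia.
(* A candidate for [b] is the position in [u] of the letter [v a]. *)
pose Q (b : 'I_n) := (a < b) && (u a < u b <= v a).
have Qc : Q (u^-1 (v a))%g.
  rewrite /Q permKV lt_a leqnn !andbT ltn_neqAle; apply/andP; split.
    by rewrite val_eqE; apply: contraNneq neq_a => {1}->; rewrite permKV.
  rewrite leqNgt; apply/negP => /[dup] lt_c /same.
  by rewrite permKV => /perm_inj e; move: lt_c; rewrite -e ltnn.
case: (arg_minnP val Qc) => b /and3P[ab uab ubv] min_b.
exists a, b; split=> // i j; rewrite rank_tperm //.
case: (boolP ((a < i <= b) && _)) => [/andP[/andP[ai ib] /andP[uj ju]]|_];
  last by rewrite addn0 uv.
(* Between [j] and [v a], only positions before [a] contribute to [rank u i]. *)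
have key : rank u i j + rank v a (v a).+1 = rank u i (v a).+1 + rank v a j.
  rewrite -!(rank_common_prefix _ same) /rank /letters_ge -!big_split.
  apply: eq_bigr => c _ /=.
  have := min_b c; rewrite /Q /=.
  case: (ltngtP c a) => [|ac|/val_inj ->]; lia.
have ja : j <= v a by lia.
have := uv i (v a).+1; have := @rank_window n v _ _ _ _ ai (leqW ja).
rewrite !rankS ja ltnn; lia.
Qed.

(** Raising steps lengthen [u] while keeping it below [v], so they must reach [v]
    after finitely many of them. *)
Lemma bruhat_rank n (u v : 'S_n) : (forall i j, rank u i j <= rank v i j) -> bruhat u v.
Proof.
have [k] := ubnP (#|{: 'I_n * 'I_n}| - perm_length u).
elim: k u => // k IH u lek uv.
have [->|neq] := eqVneq u v; first exact: connect0.
have [a [b [ab uab uv']]] := rank_raise uv neq.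
have lt_len := perm_length_tperm ab uab.
apply: (@connect_trans _ _ (tperm a b * u)%g).
  apply: connect1; rewrite /bruhat_step lt_len andbT.
  by apply/existsP; exists a; apply/existsP; exists b.
have bound : perm_length (tperm a b * u)%g <= #|{: 'I_n * 'I_n}| by exact: max_card.
apply: IH uv'; lia.
Qed.

(** * The parity-split invariant *)

Lemma rank_succ_le n (w : 'S_n) i j : rank w i.+1 j <= (j < n) + rank w i j.
Proof.
have [lt_in|ge_in] := ltnP i n.
  rewrite (@rankS _ w (Ordinal lt_in)) addnC leq_add2r.
  by have := ltn_ord (w (Ordinal lt_in)); lia.
apply: (leq_trans _ (leq_addl _ _)); apply: leq_sum => a _.
by have := ltn_ord a; lia.
Qed.

(** Positions are 0-based: [o] counts the even ones, which are the odd positions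
    of the usual one-line notation. *)
Definition in_prefixes (o e : nat) : pred nat :=
  fun a => a./2 < (if odd a then e else o).

(** The bounds on [o] and [e] ensure that exactly [o + e] letters of [v] are
    counted. *)
Definition parity_dominated n (w v : 'S_n) : Prop := forall o e j,
  o <= uphalf n -> e <= n./2 -> rank w (o + e) j <= letters_ge v (in_prefixes o e) j.

(** A prefix of length [k] consists of the first [uphalf k] even and the first
    [k./2] odd positions. *)
Lemma parity_dominated_bruhat n (w v : 'S_n) : parity_dominated w v -> bruhat w v.
Proof.
move=> dom; apply: bruhat_rank => i j.
suff small k : k <= n -> rank w k j <= rank v k j.
  have trunc (u : 'S_n) : rank u i j = rank u (minn i n) j.
    by apply: eq_letters_ge => a; have := ltn_ord a; lia.
  by rewrite !trunc small ?geq_minr.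
move=> kn; have -> : rank v k j = letters_ge v (in_prefixes (uphalf k) k./2) j.
  by apply: eq_letters_ge => a; rewrite /in_prefixes; case: ifP; lia.
have := @dom (uphalf k) k./2 j; rewrite uphalf_half -addnA addnn odd_double_half.
by apply; lia.
Qed.

(** * Insertion of the largest letter *)

Lemma letters_ge_lift m (i : 'I_m.+1) (w : 'S_m) D j :
  letters_ge (lift_perm i ord_max w) D j =
  (D i && (j <= m)) + letters_ge w (fun a => D (bump i a)) j.
Proof.
rewrite /letters_ge (bigD1_ord i) //= lift_perm_id /=; congr (_ + _).
by apply: eq_bigr => a _; rewrite lift_perm_lift lift_max.
Qed.

Lemma letters_ge_mul n (s w : 'S_n) (D E : pred nat) j :
  (forall a : 'I_n, D a = E (s a)) -> letters_ge (s * w)%g D j = letters_ge w E j.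
Proof.
move=> DE; rewrite /letters_ge [RHS](reindex_perm s) /=.
by apply: eq_bigr => a _; rewrite permM DE.
Qed.

Lemma rank_ins m (p : 'I_m.+1) (w : 'S_m) i j :
  rank (ins p.+1 w) i j = ((p < i) && (j <= m)) + rank w (i - (p < i)) j.
Proof.
rewrite /rank /ins /= inord_val letters_ge_lift; congr (_ + _).
by apply: eq_letters_ge => a; rewrite /bump; lia.
Qed.

(** The swaps compensate the shift caused by the insertion on the parity class
    opposite to that of [q], and double it on the class of [q]. *)
Lemma letters_ge_inss m q (v : 'S_m) o e j : q <= m -> ~~ odd (m - q) ->
  letters_ge (inss q.+1 v) (in_prefixes o e) j =
  (in_prefixes o e q && (j <= m)) +
  letters_ge v (if odd q then in_prefixes o (e - (q./2 < e))
                else in_prefixes (o - (q./2 < o)) e) j.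
Proof.
move=> qm odd_mq; rewrite /inss /= letters_ge_lift inordK ?ltnS //; congr (_ + _).
apply: letters_ge_mul => a; rewrite swap_permE // /in_prefixes /swap_pos /bump.
case: (boolP (odd q)) => oq; (case: (leqP q a) => qa;
  [case: (boolP (odd (a - q))) => oa|]); rewrite /=.
all: repeat (case: ifP => ?); lia.
Qed.

(** The hypothesis on [p] makes the new letter of the first word lie outside the
    prefix of length [o + e] whenever the new letter of the second word is not
    counted, as the other class contributes at most [uphalf m] positions. *)
Lemma parity_dominated_ins m (w v : 'S_m) (p : 'I_m.+1) q :
  q <= m -> ~~ odd (m - q) -> p = q./2 + uphalf m :> nat ->
  parity_dominated w v -> parity_dominated (ins p.+1 w) (inss q.+1 v).
Proof.
move=> qm odd_mq pq dom o e j le_o le_e; rewrite rank_ins letters_ge_inss //.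
(* [d] tells whether the letter inserted into [v] is counted. *)
set d := if odd q then q./2 < e else q./2 < o.
have -> : in_prefixes o e q = d by rewrite /in_prefixes /d; case: ifP.
have IH : rank w (o + e - d) j <=
    letters_ge v (if odd q then in_prefixes o (e - (q./2 < e))
                  else in_prefixes (o - (q./2 < o)) e) j.
  rewrite /d; case: ifP => oq.
    rewrite -addnBA; last by lia.
    by apply: dom; lia.
  rewrite addnC -addnBA; last by lia.
  by rewrite addnC; apply: dom; lia.
have [lt_p|ge_p] := ltnP p (o + e).
  have dT : d by rewrite /d; case: ifP; lia.
  by move: IH; rewrite dT leq_add2l.
(* The new letter of [w] is beyond the prefix, which may have one more old
   letter than the induction hypothesis accounts for. *)
rewrite subn0; apply: leq_trans (leq_add (leqnn _) IH).
case: d {IH}; last by rewrite subn0.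
case: (o + e) => [|i]; first exact: leq_addl.
rewrite subn1 /=; have := rank_succ_le w i j; lia.
Qed.

(** * Reverse-complement *)

Lemma sum_perm_ge n (w : 'S_n) c : c <= n -> \sum_(a < n) (c <= w a) + c = n.
Proof.
move=> cn; suff -> : \sum_(a < n) (c <= w a) = n - c by rewrite subnK.
have -> : \sum_(a < n) (c <= w a) = \sum_(a < n) (c <= a).
  by rewrite [RHS](reindex_perm w).
elim: n {w cn} => [|n IHn]; first by rewrite big_ord0.
by rewrite big_ord_recr /= IHn; lia.
Qed.

(** A letter at least [j] becomes a letter below [n - j], so counting over [D]
    turns into counting small letters over the reversal of [D]; the [j] letters
    that are at least [n - j] are split between that set and its complement. *)
Lemma letters_ge_reverse_complement n (w : 'S_n) (D E : pred nat) j : j <= n ->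
  (forall a : 'I_n, E a = ~~ D (rev_ord a)) ->
  letters_ge (reverse_complement w) D j + j = \sum_(a < n) D a + letters_ge w E (n - j).
Proof.
move=> jn DE; have eqj := sum_perm_ge w (leq_subr j n).
suff : letters_ge (reverse_complement w) D j + \sum_(a < n) (n - j <= w a)
       = \sum_(a < n) D a + letters_ge w E (n - j) by lia.
rewrite /letters_ge (reindex_inj rev_ord_inj) /= [in RHS](reindex_inj rev_ord_inj) /=.
rewrite -!big_split; apply: eq_bigr => a _ /=.
rewrite reverse_complementE rev_ordK DE /=.
by move: (ltn_ord (w a)) {eqj DE}; case: (D _) => //=; lia.
Qed.

(** In odd length, reversal preserves the parity of positions, so the complement
    of a reversed pair of parity prefixes is again such a pair. *)
Lemma parity_dominated_reverse_complement n (w v : 'S_n) : odd n ->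
  parity_dominated w v ->
  parity_dominated (reverse_complement w) (reverse_complement v).
Proof.
move=> odd_n dom o e j le_o le_e.
rewrite /rank; have [lt_jn|nj] := ltnP j n; last by rewrite letters_ge_eq0.
have jn := ltnW lt_jn; rewrite -(leq_add2r j).
rewrite (letters_ge_reverse_complement
  (E := fun a => a < (uphalf n - o) + (n./2 - e)) w jn);
  last by move=> a; have := ltn_ord a; rewrite /=; lia.
rewrite (letters_ge_reverse_complement
  (E := in_prefixes (uphalf n - o) (n./2 - e)) v jn); last first.
  move=> a; have := ltn_ord a; rewrite /in_prefixes /=.
  by do 2?[case: ifP => ?]; lia.
apply: leq_add; last by apply: dom; exact: leq_subr.
(* At [j = 0] the invariant compares the numbers of counted positions. *)
have := dom o e 0 le_o le_e; rewrite /rank /letters_ge.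
by under eq_bigr do rewrite andbT; under [in X in _ <= X]eq_bigr do rewrite andbT.
Qed.

(** * The base case *)

Lemma of_oneline_oneline n (v : 'S_n) : of_oneline n (oneline v) = v.
Proof.
rewrite /of_oneline; case: pickP => [u /eqP/eq_in_map uv|/(_ v)] /=; last by rewrite eqxx.
by apply/permP=> i; apply/val_inj/succn_inj/uv; rewrite mem_enum.
Qed.

Lemma letters_ge_oneline n (w : 'S_n) D j :
  letters_ge w D j = \sum_(0 <= a < n) (D a && (j < nth 0 (oneline w) a)).
Proof.
rewrite big_mkord; apply: eq_bigr => a _.
by rewrite (nth_map a) ?size_enum_ord // nth_ord_enum.
Qed.

Lemma oneline4 (w : 'S_4) : oneline w =
  [seq (w i).+1 | i <- [:: @Ordinal 4 0 isT; @Ordinal 4 1 isT;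
                           @Ordinal 4 2 isT; @Ordinal 4 3 isT]].
Proof.
rewrite /oneline; congr map; apply: (inj_map val_inj); exact: val_enum_ord.
Qed.

Lemma f_map4_cases (w : 'S_4) : w \in frakA 4 ->
  (oneline w, oneline (f_map w)) \in
    [:: ([:: 1; 2; 3; 4], [:: 1; 2; 3; 4]); ([:: 1; 2; 4; 3], [:: 1; 4; 3; 2]);
        ([:: 2; 1; 3; 4], [:: 3; 2; 1; 4]); ([:: 2; 1; 4; 3], [:: 3; 4; 1; 2])].
Proof.
move=> /split_permsP wA; have -> : f_map w = f_base w by [].
pose i0 := @Ordinal 4 0 isT; pose i1 := @Ordinal 4 1 isT.
pose i2 := @Ordinal 4 2 isT; pose i3 := @Ordinal 4 3 isT.
have shape : oneline w \in [:: [:: 1; 2; 3; 4]; [:: 1; 2; 4; 3];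
                                [:: 2; 1; 3; 4]; [:: 2; 1; 4; 3]].
  have neq (a b : 'I_4) : a != b -> w a != w b :> nat.
    by move=> ab; rewrite val_eqE (inj_eq perm_inj).
  have := neq i0 i1 isT; have := neq i2 i3 isT.
  have := wA i0; have := wA i1; have := wA i2; have := wA i3.
  rewrite oneline4 /= -/i0 -/i1 -/i2 -/i3.
  case: (w i0) => [[|[|[|[|?]]]]] //= _; case: (w i1) => [[|[|[|[|?]]]]] //= _;
  case: (w i2) => [[|[|[|[|?]]]]] //= _; by case: (w i3) => [[|[|[|[|?]]]]].
(* [of_oneline] returns a word as intended once a permutation spelling it is
   exhibited. *)
have image (v : 'S_4) s : oneline v = s -> oneline (of_oneline 4 s) = s.
  by move=> <-; rewrite of_oneline_oneline.
rewrite /f_base; move: shape; rewrite !inE.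
case/or4P => /eqP -> /=.
- by rewrite (image 1%g) // oneline4 /= !perm1.
- by rewrite (image (tperm i1 i3)) // oneline4 /= !permE.
- by rewrite (image (tperm i0 i2)) // oneline4 /= !permE.
- by rewrite (image (tperm i0 i2 * tperm i1 i3)%g) // oneline4 /= !permE /= !permE.
Qed.

Lemma parity_dominated_base (w : 'S_4) : w \in frakA 4 -> parity_dominated w (f_map w).
Proof.
move=> /f_map4_cases; rewrite !inE => cases o e j le_o le_e.
rewrite /rank !letters_ge_oneline unlock.
by case/or4P: cases => /eqP[-> ->];
   case: o e le_o le_e => [|[|[|?]]] [|[|[|?]]] //= _ _; lia.
Qed.

(** * The recursion *)

Lemma reverse_complementK n : involutive (@reverse_complement n).
Proof. by move=> w; apply/permP=> x; rewrite !reverse_complementE !rev_ordK. Qed.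

Lemma split_perms_reverse_complement n t (w : 'S_n) : t <= n ->
  w \in split_perms n t -> reverse_complement w \in split_perms n (n - t).
Proof.
move=> tn /split_permsP H; apply/split_permsP => i; rewrite reverse_complementE /=.
have := H (rev_ord i); have := ltn_ord (w (rev_ord i)); have := ltn_ord i.
rewrite /=; lia.
Qed.

Lemma f_map_parity_dominated n (w : 'S_n) :
  4 <= n -> w \in frakA n -> parity_dominated w (f_map w).
Proof.
elim: n w => // m IH w; rewrite leq_eqVlt => /orP[/eqP[em]|lt_4m].
  by subst m; exact: parity_dominated_base.
have -> : f_map w = f_step (f_map (n := m)) w by rewrite /= leqNgt lt_4m.
have IHm := IH _ (lt_4m : 4 <= m); rewrite /f_step /frakA.
case: ifP => odd_n wA.
  have halfE : m.+1./2 = m./2 by lia.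
  rewrite halfE in wA; have [|i [a [ki aA -> ->]]] := ins_decompP _ wA; first by lia.
  have lt_i := ltn_ord i.
  have -> : 2 * (i.+1 - m./2) - 1 = (2 * (i - m./2)).+1 by lia.
  by apply: parity_dominated_ins (IHm _ aA); lia.
(* Here the word [a] has its longer block first, and reverse-complement brings
   it into [frakA m]. *)
have halfE : m.+1./2 = uphalf m by lia.
rewrite halfE in wA; have [|i [a [ki aA -> ->]]] := ins_decompP _ wA; first by lia.
have lt_i := ltn_ord i.
have -> : 2 * (i.+1 - m./2 - 1) = (2 * (i - m./2)).-1.+1 by lia.
apply: parity_dominated_ins; [lia|lia|lia|].
rewrite -{1}[a]reverse_complementK.
apply: parity_dominated_reverse_complement; first by lia.
apply: IHm; rewrite /frakA.
have -> : m./2 = m - uphalf m by lia.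
by apply: split_perms_reverse_complement aA; lia.
Qed.

Theorem theorem7p7 (n : nat) (hn : 4 <= n <= 13) (w : {perm 'I_n})
  (hw : w \in frakA n) : bruhat w (f_map w).
Proof.
have /andP[n_ge4 _] := hn.
exact: parity_dominated_bruhat (f_map_parity_dominated n_ge4 hw).
Qed.
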